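(* Let $n\geq1$, let $M\in\mathbb{Z}^{n\times n}$ be an integral matrix with $\det M\neq0$, and let $t\geq1$ be an integer. Then: (a) a set $\mathcal{L}$ of unit cubes is a hyper-L of $G_M$ if and only if $t\mathcal{L}$ is a hyper-L of $G_{tM}$; (b) for every hyper-L $\mathcal{L}$ of $G_M$, $k(t\mathcal{L})=t(k(\mathcal{L})+n)-n$; (c) a set $\mathcal{H}$ of unit cubes is a minimum distance diagram of $G_M$ if and only if $t\mathcal{H}$ is a minimum distance diagram of $G_{tM}$; (d) $k(G_{tM})=t(k(G_M)+n)-n$.
   Context: For an integral nonsingular $n\times n$ matrix $A$, $G_A=\mathrm{Cay}(\mathbb{Z}^n/A\mathbb{Z}^n,\{e_1,\ldots,e_n\})$, where $e_1,\ldots,e_n$ is the canonical basis of $\mathbb{Z}^n$; $a\equiv b\pmod A$ means $a-b\in A\mathbb{Z}^n$. For $a\in\mathbb{Z}^n$, $[a]=[a_1,a_1+1)\times\cdots\times[a_n,a_n+1)\subset\mathbb{R}^n$ is a unit cube. $\mathbb{N}=\mathbb{Z}_{\geq0}$; $\leq$ on vectors is coordinatewise; for $a\in\mathbb{N}^n$, $\nabla(a)=\{[b]:0\leq b\leq a\}$. For a finite Abelian group $\Gamma=\langle\gamma_1,\ldots,\gamma_n\rangle$ of order $N$, let $\phi:\mathbb{N}^n\to\Gamma$, $\phi(a)=\sum a_i\gamma_i$. A hyper-L of $\mathrm{Cay}(\Gamma,\{\gamma_1,\ldots,\gamma_n\})$ is a set $\mathcal{L}$ of $N$ unit cubes $[a]$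 with $a\in\mathbb{N}^n$ such that (i) $\{\phi(a):[a]\in\mathcal{L}\}=\Gamma$ and (ii) $[a]\in\mathcal{L}\Rightarrow\nabla(a)\subset\mathcal{L}$. For $G_A$, $\Gamma=\mathbb{Z}^n/A\mathbb{Z}^n$ and $\phi(a)$ is the class of $a$. With $\|x\|=|x_1|+\cdots+|x_n|$, the diameter of a hyper-L is $k(\mathcal{L})=\max\{\|a\|:[a]\in\mathcal{L}\}$. A minimum distance diagram (MDD) is a hyper-L $\mathcal{H}$ such that $\|a\|=\min\{\|x\|: x\in\mathbb{N}^n,\ \phi(x)=\phi(a)\}$ for all $[a]\in\mathcal{H}$. $k(G)$ denotes the (directed) diameter of the Cayley digraph $G$. For an integer $t\geq1$, $t[a]=\{[ta+\alpha]:\alpha\in\mathbb{Z}^n,\ 0\leq\alpha_i\leq t-1\ \forall i\}$, and $t\mathcal{L}=\bigcup_{[a]\in\mathcal{L}}t[a]$. *)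

(* Defs.v *)
From HB Require Import structures.
From mathcomp Require Import all_boot all_order all_algebra.
From mathcomp Require Import all_classical all_reals.

Set Implicit Arguments.
Unset Strict Implicit.
Unset Printing Implicit Defensive.

Import Order.TTheory GRing.Theory Num.Theory.

Local Open Scope classical_set_scope.
Local Open Scope card_scope.
Local Open Scope ring_scope.
Local Open Scope quotient_scope.

(* [supremum 0 S] and [infimum 0 S] on nat are the maximum of a nonempty
   bounded set and the minimum of a nonempty set; the default 0 is returned on
   the empty set, and by [supremum] also on an unbounded one. *)
Definition max_nat (S : set nat) : nat := supremum 0%N S.
Definition min_nat (S : set nat) : nat := infimum 0%N S.

Section Digraph.
Variables (V : eqType) (arc : rel V).

(* A walk from [x] is the sequence [p] of its vertices other than [x], so that
   its length is [size p]. *)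
Definition dist (x y : V) : nat :=
  min_nat [set size p | p in [set p : seq V | path arc x p /\ last x p = y]].

Definition diameter : nat :=
  max_nat [set d | exists x y : V, d = dist x y].

End Digraph.

Definition cayley (G : zmodType) (n : nat) (g : 'I_n -> G) : rel G :=
  fun x y => [exists i, y == x + g i].

(* N^n is the set of nonnegative vectors of Z^n. *)
Definition natvec (n : nat) : set 'cV[int]_n :=
  [set a | forall i, 0 <= a i 0].

Definition norm1 (n : nat) (a : 'cV[int]_n) : nat := (\sum_i `|a i 0%R|)%N.

Section QuotientGroup.
Variables (n : nat) (A : 'M[int]_n).

Definition lattice : {pred 'cV[int]_n} :=
  fun a => `[< exists z : 'cV[int]_n, a = A *m z >].

Lemma lattice_zmod_closed : zmod_closed lattice.
Proof.
split; first by apply/asboolP; exists 0; rewrite mulmx0.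
move=> a b /asboolP[y ->] /asboolP[z ->].
by apply/asboolP; exists (y - z); rewrite mulmxBr.
Qed.

HB.instance Definition _ :=
  GRing.isZmodClosed.Build 'cV[int]_n lattice lattice_zmod_closed.

Definition Zn_mod : zmodType := Quotient.quot lattice.

Definition Zn_mod_gen (i : 'I_n) : Zn_mod :=
  \pi_(Quotient.quot lattice) (delta_mx i 0 : 'cV[int]_n).

Definition cayley_mx : rel Zn_mod := cayley Zn_mod_gen.

End QuotientGroup.
Arguments Zn_mod_gen {n} A i.
Arguments cayley_mx {n} A _ _.

Section Cubes.
Variables (R : realType) (n : nat).
Local Notation cubes := (set (set 'cV[R]_n)).

Definition cube (a : 'cV[int]_n) : set 'cV[R]_n :=
  [set x | forall i, (a i 0)%:~R <= x i 0 < (a i 0)%:~R + 1].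

Definition unit_cubes : cubes := range cube.

Definition nabla (a : 'cV[int]_n) : cubes :=
  cube @` [set b : 'cV[int]_n | forall i, 0 <= b i 0 <= a i 0].

Definition dilate_cube (t : nat) (a : 'cV[int]_n) : cubes :=
  [set cube (t%:Z *: a + alpha) | alpha in
     [set alpha : 'cV[int]_n | forall i, 0 <= alpha i 0 <= t%:Z - 1]].

Definition dilate (t : nat) (L : cubes) : cubes :=
  \bigcup_(a in [set a | L (cube a)]) dilate_cube t a.

Definition diam_cubes (L : cubes) : nat :=
  max_nat [set norm1 a | a in [set a | L (cube a)]].

Section HyperL.
Variables (G : zmodType) (g : 'I_n -> G).

(* The map phi; only its values on N^n are used below. *)
Definition weight (a : 'cV[int]_n) : G := \sum_i g i *~ a i 0.

(* [N] is the order of [G], which is thereby finite. *)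
Definition hyperL (L : cubes) : Prop :=
  exists N : nat,
    [/\ [set: G] #= `I_N,
        L `<=` cube @` @natvec n /\ L #= `I_N,
        weight @` [set a | natvec a /\ L (cube a)] = [set: G] &
        forall a, L (cube a) -> nabla a `<=` L].

Definition mdd (H : cubes) : Prop :=
  hyperL H /\
  forall a, H (cube a) ->
    norm1 a = min_nat [set norm1 x | x in
                         [set x | natvec x /\ weight x = weight a]].

End HyperL.
End Cubes.

Definition hyperL_mx (R : realType) (n : nat) (A : 'M[int]_n)
  (L : set (set 'cV[R]_n)) : Prop := hyperL (Zn_mod_gen A) L.

Definition mdd_mx (R : realType) (n : nat) (A : 'M[int]_n)
  (H : set (set 'cV[R]_n)) : Prop := mdd (Zn_mod_gen A) H.

(* Main.v *)
(* Write b in Z^n as t q + r with digits 0 <= r_i < t.  Then [b] lies in t L iff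
   [q] lies in L, and b = b' mod tM iff r = r' and q = q' mod M; on nonnegative
   vectors |b| = t |q| + |r|.  A hyper-L is a finite down-closed transversal
   of Z^n / A Z^n inside N^n, so this property passes from L modulo M to t L
   modulo tM and back.  A shortest nonnegative representative of b modulo tM has
   the digits r and as quotient a shortest representative of q modulo M; maximal
   lengths occur at the digit vector (t-1, ..., t-1), of length n (t-1).  The
   diameter is the maximum of the shortest lengths over all classes, so no MDD
   has to be constructed for it. *)

Require Import Defs.
From mathcomp Require Import all_boot all_order all_algebra.
From mathcomp Require Import all_classical all_reals.
From mathcomp Require Import zify.
Import Order.TTheory GRing.Theory Num.Theory.
Local Open Scope classical_set_scope.
Local Open Scope card_scope.
Local Open Scope ring_scope.

(** * Minima and maxima of sets of naturals; surjections between finite sets *)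

Lemma min_natE (S : set nat) m : S m -> lbound S m -> min_nat S = m.
Proof.
move=> Sm lbm; have Im : infimums S m by split=> // k; apply.
rewrite /min_nat /infimum ifF; last by apply/negP => /eqP S0; rewrite S0 in Sm.
by case: xgetP => [k _ Ik|/(_ m)//]; exact: is_subset1_infimums Ik Im.
Qed.

Lemma min_natP (S : set nat) : S !=set0 -> S (min_nat S) /\ lbound S (min_nat S).
Proof.
move=> [k0 Sk0]; have exS : exists k, `[< S k >] by exists k0; apply/asboolP.
have [m /asboolP Sm mmin] := ex_minnP exS.
have lbm : lbound S m by move=> k Sk; rewrite leEnat; apply: mmin; apply/asboolP.
by rewrite (min_natE _ _ Sm lbm).
Qed.

Lemma max_natE (S : set nat) m : S m -> ubound S m -> max_nat S = m.
Proof.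
move=> Sm ubm; have Im : supremums S m by split=> // k; apply.
rewrite /max_nat /supremum ifF; last by apply/negP => /eqP S0; rewrite S0 in Sm.
by case: xgetP => [k _ Ik|/(_ m)//]; exact: is_subset1_supremums Ik Im.
Qed.

Lemma max_natP (S : set nat) : S !=set0 -> has_ubound S ->
  S (max_nat S) /\ ubound S (max_nat S).
Proof.
move=> [k0 Sk0] [u ubu]; have exS : exists k, `[< S k >] by exists k0; apply/asboolP.
have ubS k : `[< S k >] -> (k <= u)%N by move=> /asboolP /ubu; rewrite leEnat.
have [m /asboolP Sm mmax] := ex_maxnP exS ubS.
have ubm : ubound S m by move=> k Sk; rewrite leEnat; apply: mmax; apply/asboolP.
by rewrite (max_natE _ _ Sm ubm).
Qed.

Lemma finite_nat_ubound (S : set nat) : finite_set S -> has_ubound S.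
Proof.
move=> /finite_seqP[s ->]; exists (\max_(k <- s) k)%N => k /= ks.
by rewrite leEnat; exact: (@leq_bigmax_seq _ s xpredT id k).
Qed.

(** Nonemptiness matters: on the empty set the left side is the default 0, the right side [c]. *)
Lemma min_nat_affine (S : set nat) (t c : nat) : S !=set0 ->
  min_nat [set (t * k + c)%N | k in S] = (t * min_nat S + c)%N.
Proof.
move=> /min_natP[Sm lbm]; apply: min_natE; first by exists (min_nat S).
move=> _ /= [k /lbm le_mk <-].
by rewrite leEnat leq_add2r leq_mul2l -leEnat le_mk orbT.
Qed.

(** If [a] and [b] were distinct with equal images, removing [a] would keep the image, and the
    finite set [S] would be equipotent to the proper subset missing [a]. *)
Lemma finite_surj_inj {T U : choiceType} (f : T -> U) (S : set T) :
  finite_set S -> f @` S #= S -> {in S &, injective f}.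
Proof.
move=> finS cardS a b /set_mem Sa /set_mem Sb fab; apply: contrapT => nab.
have imD : f @` S = f @` (S `\ a).
  apply/seteqP; split=> _ [c Sc <-]; last by exists c => //; case: Sc.
  have [->|nca] := eqVneq c a; first by exists b => //; split=> // /esym.
  by exists c => //; split=> //; apply/eqP.
have finD : finite_set (S `\ a) by apply: finite_setD.
have le_SD : S #<= S `\ a.
  by rewrite -(card_le_eql cardS) imD card_image_le.
have : S `\ a #= S by rewrite card_eq_le le_SD andbT; apply: subset_card_le => c [].
move=> /(fcard_eq finD finS); rewrite fset_setD1 // => cardE.
have := @finmap.cardfsD1 _ a (fset_set S).
by rewrite in_fset_set // mem_set // cardE => /n_Sn.
Qed.

Lemma subr_shift (V : zmodType) (x y u v : V) :
  y - (x + v) - u = y - x - (u + v).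
Proof. by rewrite -!addrA; congr (_ + _); rewrite -!opprD addrAC -addrA. Qed.

(** * Coordinatewise Euclidean division by [t] *)

Section DivMod.
Context {n : nat}.
Implicit Types (t : nat) (a b c r : 'cV[int]_n) (M : 'M[int]_n).

Definition divv t b : 'cV[int]_n := \col_i (b i 0%R %/ t%:Z)%Z.
Definition modv t b : 'cV[int]_n := \col_i (b i 0%R %% t%:Z)%Z.

Lemma divv_coord t b i : b i 0 = t%:Z * divv t b i 0 + modv t b i 0.
Proof. by rewrite !mxE {1}(divz_eq (b i 0) t) mulrC. Qed.

Lemma divv_eq t b : b = t%:Z *: divv t b + modv t b.
Proof. by apply/colP => i; rewrite {1}(divv_coord t b i) !mxE. Qed.

Lemma modv_ge0 t b i : (0 < t)%N -> 0 <= modv t b i 0.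
Proof. by move=> t0; rewrite mxE modz_ge0 //; lia. Qed.

Lemma modv_lt t b i : (0 < t)%N -> modv t b i 0 < t%:Z.
Proof. by move=> t0; rewrite mxE ltz_pmod //; lia. Qed.

Lemma divvD t a r : (forall i, 0 <= r i 0 < t%:Z) -> divv t (t%:Z *: a + r) = a.
Proof.
move=> r_lt; apply/colP => i; have := r_lt i; rewrite !mxE => ri.
by rewrite mulrC divzMDl ?divz_small ?addr0 //; lia.
Qed.

Lemma modvD t a r : (forall i, 0 <= r i 0 < t%:Z) -> modv t (t%:Z *: a + r) = r.
Proof.
move=> r_lt; apply/colP => i; have := r_lt i; rewrite !mxE => ri.
by rewrite mulrC modzMDl modz_small //; lia.
Qed.

Lemma divvZ t a : (0 < t)%N -> divv t (t%:Z *: a) = a.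
Proof. by move=> t0; rewrite -[_ *: a]addr0 divvD // => i; rewrite mxE; lia. Qed.

Lemma modvZ t a : (0 < t)%N -> modv t (t%:Z *: a) = 0.
Proof. by move=> t0; rewrite -[_ *: a]addr0 modvD // => i; rewrite mxE; lia. Qed.

Lemma natvec_divv t b : (0 < t)%N -> natvec (divv t b) <-> natvec b.
Proof.
move=> t0; split=> b0 i; have := b0 i; rewrite mxE divz_ge0 //; lia.
Qed.

Lemma in_lattice M a : reflect (exists z, a = M *m z) (a \in lattice M).
Proof. exact: asboolP. Qed.

(** If [b - c] is [t] times [M *m z], then adding [M *m z] to the quotient of [c] and keeping its
    digits gives a division of [b] by [t], and such a division is unique. *)
Lemma lattice_scale t M b c : (0 < t)%N ->
  (b - c \in lattice (t%:Z *: M)) =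
  (modv t b == modv t c) && (divv t b - divv t c \in lattice M).
Proof.
move=> t0; apply/in_lattice/andP => [[z bcE]|[/eqP modE /in_lattice[z divE]]].
  have bE : b = t%:Z *: (divv t c + M *m z) + modv t c.
    rewrite scalerDr scalemxAl -bcE addrAC -divv_eq; exact/esym/subrKC.
  have mod_c i : 0 <= modv t c i 0 < t%:Z by rewrite modv_ge0 ?modv_lt.
  split; first by rewrite bE modvD.
  by apply/in_lattice; exists z; rewrite {1}bE divvD // addrC addrA addNr add0r.
exists z; rewrite -scalemxAl -divE [in LHS](divv_eq t b) [in LHS](divv_eq t c) modE.
by rewrite opprD addrACA subrr addr0 -scalerBr.
Qed.

Lemma norm1_divv t b : (0 < t)%N -> natvec b ->
  norm1 b = (t * norm1 (divv t b) + norm1 (modv t b))%N.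
Proof.
move=> t0 b0; rewrite /norm1 big_distrr -big_split /=; apply: eq_bigr => i _.
have := modv_ge0 t b i t0; have := (natvec_divv t b t0).2 b0 i.
have := divv_coord t b i.
move: (divv t b i 0) (modv t b i 0) (b i 0) => q r x -> q0 r0.
nia.
Qed.

Lemma norm1_modv t b : (0 < t)%N -> (norm1 (modv t b) <= n * t.-1)%N.
Proof.
move=> t0; rewrite /norm1.
have -> : (n * t.-1 = \sum_(i < n) t.-1)%N by rewrite sum_nat_const card_ord.
apply: leq_sum => i _; have := modv_ge0 t b i t0; have := modv_lt t b i t0; lia.
Qed.

End DivMod.

(** * Lengths of nonnegative representatives of a class *)

Section Lengths.
Context {n : nat}.
Implicit Types (t : nat) (a b x y : 'cV[int]_n) (A M : 'M[int]_n).

Local Notation pi A := (\pi_(Quotient.quot (lattice A))%qT).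

Lemma pi_eqP A x y : reflect (pi A x = pi A y) (x - y \in lattice A).
Proof. by rewrite Quotient.idealrBE; exact: eqP. Qed.

Lemma weight_pi A a : weight (Zn_mod_gen A) a = pi A a.
Proof.
rewrite [in RHS](matrix_sum_delta a) raddf_sum; apply: eq_bigr => i _.
by rewrite big_ord1 -[a i 0 in RHS]intz scaler_int raddfMz.
Qed.

(** Congruence is kept at the level of vectors, where [lattice_scale] applies; [dist_lengths]
    identifies the minima of these sets with distances in the digraph. *)
Definition lengths A x : set nat :=
  [set norm1 a | a in [set a | natvec a /\ x - a \in lattice A]].

Lemma natvec_weight_lengths A a :
  [set norm1 x | x in [set x | natvec x /\
     weight (Zn_mod_gen A) x = weight (Zn_mod_gen A) a]] = lengths A a.
Proof.
apply/seteqP; split=> _ [x [x0 /= xE] <-]; exists x => //; split=> //.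
  by apply/pi_eqP; move: xE; rewrite !weight_pi.
by rewrite /= !weight_pi; apply/esym/pi_eqP.
Qed.

Lemma lengths_neq0 A a : natvec a -> lengths A a !=set0.
Proof. by move=> a0; exists (norm1 a), a => //; split; rewrite ?subrr ?rpred0. Qed.

(** All multiples of [d], the absolute value of the determinant, lie in the lattice, so the digits
    of [x] in base [d] are a nonnegative representative. The bound does not depend on [x], which
    later bounds the diameter. *)
Lemma lengths_le A x : \det A != 0 ->
  exists2 k, lengths A x k & (k <= n * (absz (\det A)).-1)%N.
Proof.
move=> detA; set d := absz (\det A); have d0 : (0 < d)%N by rewrite absz_gt0.
exists (norm1 (modv d x)); last exact: norm1_modv.
exists (modv d x) => //; split; first by move=> i; apply: modv_ge0.
rewrite {1}(divv_eq d x) addrK; apply/in_lattice.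
(* [A *m \adj A] is the scalar matrix of [\det A]; the sign turns this scalar into [d]. *)
exists (\adj A *m (sgz (\det A) *: divv d x)).
rewrite mulmxA mul_mx_adj mul_scalar_mx scalerA; congr (_ *: _).
by rewrite /d abszEsg mulrC.
Qed.

Lemma lengths_scale t M b : (0 < t)%N ->
  lengths (t%:Z *: M) b =
  [set (t * k + norm1 (modv t b))%N | k in lengths M (divv t b)].
Proof.
move=> t0; apply/seteqP; split=> [_ [a [a0 +] <-]|_ [_ [q [q0 qE] <-] <-]].
  rewrite lattice_scale // => /andP[/eqP modE divE].
  exists (norm1 (divv t a)); last by rewrite [in RHS](norm1_divv t) // modE.
  by exists (divv t a) => //; split=> //; apply/natvec_divv.
have mod_b i : 0 <= modv t b i 0 < t%:Z by rewrite modv_ge0 ?modv_lt.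
have a0 : natvec (t%:Z *: q + modv t b) by apply/(natvec_divv t); rewrite ?divvD.
exists (t%:Z *: q + modv t b).
  by split=> //; rewrite lattice_scale // divvD // modvD // eqxx.
by rewrite (norm1_divv t) // divvD // modvD.
Qed.

(** * Walks and diameters of the Cayley digraphs *)

Lemma norm1_eq0 a : norm1 a = 0%N -> a = 0.
Proof.
move=> /eqP; rewrite sum_nat_eq0 => /forallP a0; apply/colP => i.
by rewrite mxE; apply/eqP; rewrite -absz_eq0; apply: a0.
Qed.

Lemma natvec_delta (i : 'I_n) : natvec (delta_mx i 0).
Proof. by move=> j; rewrite mxE; case: (_ && _). Qed.

Lemma norm1D a b : natvec a -> natvec b -> norm1 (a + b) = (norm1 a + norm1 b)%N.
Proof.
move=> a0 b0; rewrite /norm1 -big_split; apply: eq_bigr => i _ /=.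
rewrite mxE; have := a0 i; have := b0 i.
by move: (a i 0) (b i 0) => x y; lia.
Qed.

Lemma norm1_delta (i : 'I_n) : norm1 (delta_mx i 0 : 'cV[int]_n) = 1%N.
Proof.
rewrite /norm1 (bigD1 i) //= big1 ?mxE ?eqxx // => j nji.
by rewrite mxE (negPf nji).
Qed.

(** By commutativity only the number of uses of each generator matters in a walk. These counts form
    a nonnegative vector congruent to [y - x], with norm the walk length; conversely such a vector
    can be spent one generator at a time. *)
Lemma dist_lengths A x y :
  dist (cayley_mx A) (pi A x) (pi A y) = min_nat (lengths A (y - x)).
Proof.
rewrite /dist; congr min_nat; apply/seteqP; split=> k.
  move=> [p [pathp lastp] <-]; elim: p x pathp lastp => [|z p IHp] x /=.
    move=> _ /esym/pi_eqP yx; exists 0; last first.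
      by rewrite /norm1 big1 // => i _; rewrite mxE.
    by split; [move=> i; rewrite mxE | rewrite subr0].
  move=> /andP[/existsP[i /eqP zE]].
  have -> : z = pi A (x + delta_mx i 0) by rewrite zE raddfD.
  move=> pathp lastp; have [a [a0 aE] <-] := IHp _ pathp lastp.
  exists (a + delta_mx i 0); last first.
    by rewrite norm1D ?norm1_delta ?addn1 //; exact: natvec_delta.
  split; first by move=> j; rewrite mxE addr_ge0 ?a0 //; apply: natvec_delta.
  by rewrite -subr_shift.
move=> [a [a0 aE] <-].
elim: (norm1 a) {-2}a (erefl (norm1 a)) a0 x aE
  => {a k} [|k IHk] a ak a0 x aE.
  exists [::] => //; split=> //=.
  by move: aE; rewrite (norm1_eq0 _ ak) subr0 => /pi_eqP.
have /existsP[i ai] : [exists i, a i 0 != 0].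
  rewrite -negb_forall; apply/negP => /forallP a_eq0; move: ak.
  by rewrite /norm1 big1 // => i _; rewrite (eqP (a_eq0 i)).
(* A generator with a nonzero count is used as the first arc; [b] holds the counts for the rest of
   the walk. *)
pose b := a - delta_mx i 0; have aE' : a = b + delta_mx i 0 by rewrite subrK.
have b0 : natvec b.
  move=> j; rewrite !mxE eqxx andbT; have := a0 j; case: eqP => [->|_].
    by move: ai; move: (a i 0) => k0 /= ? ?; lia.
  by rewrite subr0.
have bk : norm1 b = k.
  by move: ak; rewrite aE' norm1D ?norm1_delta ?addn1 //; [case | exact: natvec_delta].
have [|p [pathp lastp] sizep] := IHk b bk b0 (x + delta_mx i 0).
  by rewrite subr_shift -aE'.
exists (pi A (x + delta_mx i 0) :: p); last by rewrite /= sizep bk ak.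
split=> //=; rewrite pathp andbT; apply/existsP; exists i.
by rewrite raddfD.
Qed.

(** Distances are translation invariant, so those from the class of 0 already give all of them. *)
Lemma diameter_lengths A :
  diameter (cayley_mx A) = max_nat [set min_nat (lengths A x) | x in setT].
Proof.
congr max_nat; apply/seteqP; split=> k.
  move=> [x [y ->]]; elim/quotW: x => x; elim/quotW: y => y.
  by exists (y - x) => //; rewrite dist_lengths.
by move=> [x _ <-]; exists (pi A 0), (pi A x); rewrite dist_lengths subr0.
Qed.

(* The digit vector [(t-1, ..., t-1)] attains the maximum. *)
Lemma max_nat_divv t (S : set 'cV[int]_n) (F G : 'cV[int]_n -> nat) :
  (0 < t)%N -> S !=set0 -> has_ubound (F @` S) ->
  (forall b, S (divv t b) -> G b = (t * F (divv t b) + norm1 (modv t b))%N) ->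
  max_nat (G @` [set b | S (divv t b)]) = (t * (max_nat (F @` S) + n) - n)%N.
Proof.
move=> t0 S0 ubF GE; have [] := max_natP (F @` S) _ ubF; first exact: image_nonempty.
move=> [a Sa <-] ubFa.
(* Since [t] is positive, the subtraction of naturals is not truncated. *)
have tn : (t * (F a + n) - n = t * F a + n * t.-1)%N by case: t t0 {GE} => // t _; lia.
rewrite tn; apply: max_natE.
  pose r : 'cV[int]_n := const_mx (t.-1)%:Z.
  have r_lt i : 0 <= r i 0 < t%:Z by rewrite mxE; lia.
  exists (t%:Z *: a + r); rewrite /= ?GE divvD // modvD //; congr (_ + _)%N.
  rewrite /norm1 (eq_bigr (fun=> t.-1)) ?sum_nat_const ?card_ord // => i _.
  by rewrite mxE.
move=> _ [b /= Sb <-]; rewrite leEnat GE // leq_add ?norm1_modv //.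
by rewrite leq_mul2l -leEnat (ubFa _ (imageP F Sb)) orbT.
Qed.

Lemma diameter_scale t M : (0 < t)%N -> \det M != 0 ->
  diameter (cayley_mx (t%:Z *: M)) = (t * (diameter (cayley_mx M) + n) - n)%N.
Proof.
move=> t0 detM; rewrite !diameter_lengths.
have -> : [set: 'cV[int]_n] = [set b | [set: 'cV[int]_n] (divv t b)] by apply/seteqP.
rewrite (max_nat_divv t setT (fun x => min_nat (lengths M x))) //.
- by exists 0.
(* The uniform bound of [lengths_le] keeps [max_nat] away from its default value. *)
- exists (n * (absz (\det M)).-1)%N => _ [x _ <-].
  have [k xk le_k] := lengths_le M x detM.
  have [|_ lb] := min_natP (lengths M x); first by exists k.
  exact: le_trans (lb _ xk) le_k.
move=> b _; rewrite lengths_scale // min_nat_affine //.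
by have [k bk _] := lengths_le M (divv t b) detM; exists k.
Qed.

End Lengths.

(** * Sets of cubes and their sets of corners *)

Section Hyper.
Context (R : realType) {n : nat}.
Implicit Types (t : nat) (a b : 'cV[int]_n) (A M : 'M[int]_n).
Implicit Types (L : set (set 'cV[R]_n)) (S : set 'cV[int]_n).

(** Each cube contains its own corner; if two cubes agree, each corner obeys the lower bounds of the
    other, which forces equality. *)
Lemma cube_inj : injective (@cube R n).
Proof.
move=> a b ab; apply/colP => i.
have mem_cube c : @cube R n c (map_mx intr c).
  by move=> j; rewrite mxE; apply/andP; split=> //; rewrite ltrDl.
have := mem_cube a; have := mem_cube b.
rewrite {1}ab -{1}ab => /(_ i) + /(_ i); rewrite !mxE.
by rewrite -!(intrD _ _ 1) !ler_int !ltr_int; lia.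
Qed.

Lemma dilateE t L b : (0 < t)%N -> dilate t L (cube b) <-> L (cube (divv t b)).
Proof.
move=> t0; split=> [[a /= La [r r_lt /cube_inj <-]]|Lb].
  by rewrite divvD // => i; have := r_lt i; lia.
exists (divv t b) => //; exists (modv t b); last by rewrite -divv_eq.
by move=> i /=; have := modv_ge0 t b i t0; have := modv_lt t b i t0; lia.
Qed.

Lemma dilate_unit_cubes t L : dilate t L `<=` @unit_cubes R n.
Proof. by move=> _ [a _ [r _ <-]]; exists (t%:Z *: a + r). Qed.

(** This is the hyper-L condition on corners, with unique representatives in place of the count [N],
    so that it can be transported along [divv] without counting. *)
Definition staircase A S : Prop :=
  [/\ finite_set S, S `<=` @natvec n,
      forall x, exists! a, S a /\ x - a \in lattice A &
      forall a b, S a -> (forall i, 0 <= b i 0 <= a i 0) -> S b].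

(** A surjection onto a set of the same finite size is injective, so the count [N] yields uniqueness
    of representatives; conversely, bijectivity of the weight on corners recovers the order of the
    group. Consisting of unit cubes, [L] is the image of its corners. *)
Lemma hyperL_staircase A L : L `<=` @unit_cubes R n ->
  hyperL_mx A L <-> staircase A [set a | L (cube a)].
Proof.
set S := [set a | L (cube a)] => Lunit.
have LE : L = @cube R n @` S.
  apply/seteqP; split=> [c Lc|_ [a Sa <-]//]; have [a _ ac] := Lunit _ Lc.
  by exists a => //; rewrite /S /= ac.
have cardLS : L #= S by rewrite LE; apply: inj_card_eq => a b _ _ /cube_inj.
split=> [[N [cardG [Lnat cardL] surj down]]|[finS Snat uniqS down]].
  have natS : S `<=` @natvec n by move=> a /Lnat[b b0 /cube_inj <-].
  have cardS : S #= `I_N by rewrite -(card_eql cardLS).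
  have finS : finite_set S by exists N.
  have surjS : weight (Zn_mod_gen A) @` S = setT.
    rewrite -surj; congr image; apply/seteqP; split=> [a Sa|a []//].
    by split=> //; apply: natS.
  have injS : {in S &, injective (weight (Zn_mod_gen A))}.
    apply: finite_surj_inj => //; rewrite surjS.
    by rewrite (card_eqr cardS).
  split=> // [x|a b /down Sa b_le]; last by apply: Sa; exists b.
  have [a Sa ax] : (weight (Zn_mod_gen A) @` S) (weight (Zn_mod_gen A) x).
    by rewrite surjS.
  exists a; split=> [|b [Sb xb]]; first by split=> //; apply/pi_eqP; rewrite -!weight_pi.
  apply: injS; rewrite ?inE //; rewrite ax !weight_pi; exact/pi_eqP.
have [N cardS] := finS; exists N.
have surjS : weight (Zn_mod_gen A) @` S = setT.
  apply/seteqP; split=> // g _; elim/quotW: g => x.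
  have [a [[Sa /pi_eqP xa] _]] := uniqS x.
  by exists a; rewrite ?weight_pi.
have injS : {in S &, injective (weight (Zn_mod_gen A))}.
  move=> a b /set_mem Sa /set_mem Sb; rewrite !weight_pi => /pi_eqP ab.
  have [c [_ cuniq]] := uniqS a.
  have <- : c = a by apply: cuniq; split; rewrite ?subrr ?rpred0.
  by apply: cuniq.
split.
- by rewrite -surjS (card_eql (inj_card_eq injS)).
- split; last by rewrite (card_eql cardLS).
  by rewrite LE; apply: image_subset.
- rewrite -surjS; congr image; apply/seteqP; split=> [a []//|a Sa].
  by split=> //; apply: Snat.
by move=> a La _ [b b_le <-]; exact: down La b_le.
Qed.

(** There are finitely many digit vectors, so each quotient in [S] comes from finitely many [b]. *)
Lemma finite_divv t S : (0 < t)%N ->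
  finite_set S -> finite_set [set b | S (divv t b)].
Proof.
move=> t0 finS.
pose digits : set 'cV[int]_n :=
  [set \col_i (nat_of_ord (g i))%:Z | g in [set: {ffun 'I_n -> 'I_t}]].
apply: (@sub_finite_set _ _ [set t%:Z *: q + r | q in S & r in digits]); last first.
  by apply: finite_image2 => //; apply: finite_image; exact: finite_finset.
move=> b /= Sb; exists (divv t b) => //; exists (modv t b); last by rewrite -divv_eq.
have lt_t i : (absz (modv t b i 0%R) < t)%N.
  by have := modv_ge0 t b i t0; have := modv_lt t b i t0; lia.
exists [ffun i => Ordinal (lt_t i)] => //; apply/colP => i.
by rewrite [LHS]mxE ffunE /= gez0_abs // modv_ge0.
Qed.

(** Forward, the representative of [x] combines the digits of [x] with the representative in [S] of
    its quotient. Backward, each property of [S] is read off at multiples [t%:Z *: a], which have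
    quotient [a] and zero digits. *)
Lemma staircase_divv t M S : (0 < t)%N ->
  staircase M S <-> staircase (t%:Z *: M) [set b | S (divv t b)].
Proof.
move=> t0; split=> [[finS Snat uniqS down]|[finS Snat uniqS down]]; split.
- by apply: finite_divv.
- by move=> b /Snat /natvec_divv; apply.
- move=> x; have [q [[Sq xq] quniq]] := uniqS (divv t x).
  have mod_x i : 0 <= modv t x i 0 < t%:Z by rewrite modv_ge0 ?modv_lt.
  exists (t%:Z *: q + modv t x); split=> [|b [/= Sb]].
    by rewrite /= lattice_scale // divvD // modvD // eqxx.
  rewrite lattice_scale // => /andP[/eqP -> xb].
  by rewrite (quniq (divv t b)) // -divv_eq.
- move=> a b /= Sa ba; apply: down Sa _ => i; rewrite !mxE.
  have /andP[b0 b_le] := ba i.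
  rewrite divz_ge0 ?b0 ?ltz_nat //=; exact: lez_pdiv2r.
- apply: (@sub_finite_set _ _ (divv t @` [set b | S (divv t b)])).
    by move=> a Sa; exists (t%:Z *: a); rewrite /= divvZ.
  exact: finite_image.
- move=> a Sa i; have : natvec (t%:Z *: a) by apply: Snat; rewrite /= divvZ.
  by move/(natvec_divv t _ t0).2; rewrite divvZ //; apply.
- move=> x; have [b [[/= Sb]]] := uniqS (t%:Z *: x).
  rewrite lattice_scale // divvZ // modvZ // => /andP[/eqP b0 xb] buniq.
  exists (divv t b); split=> // a [Sa xa].
  rewrite (buniq (t%:Z *: a)) ?divvZ // lattice_scale // !divvZ // !modvZ //.
  by rewrite eqxx.
move=> a b Sa ba; have := down (t%:Z *: a) (t%:Z *: b).
rewrite /= !divvZ //; apply=> // i; have /andP[b0 b_le] := ba i.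
by rewrite !mxE mulr_ge0 // ler_wpM2l.
Qed.

(** * Dilation of hyper-Ls and of minimum distance diagrams *)

Lemma hyperL_dilate t M L : (0 < t)%N -> L `<=` @unit_cubes R n ->
  hyperL_mx M L <-> hyperL_mx (t%:Z *: M) (dilate t L).
Proof.
move=> t0 Lunit; rewrite !hyperL_staircase //; last exact: dilate_unit_cubes.
rewrite (staircase_divv t) //.
have -> // : [set a | dilate t L (cube a)] = [set b | L (cube (divv t b))].
by apply/seteqP; split=> b /dilateE; apply.
Qed.

Lemma hyperL_unit_cubes A L : hyperL_mx A L -> L `<=` @unit_cubes R n.
Proof. by move=> [N [_ [Lnat _] _ _]] c /Lnat[a _ <-]; exists a. Qed.

Lemma diam_dilate t M L : (0 < t)%N -> hyperL_mx M L ->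
  diam_cubes (dilate t L) = (t * (diam_cubes L + n) - n)%N.
Proof.
move=> t0 hypL.
have [finS Snat uniqS _] := (hyperL_staircase M L (hyperL_unit_cubes _ _ hypL)).1 hypL.
rewrite /diam_cubes.
have -> : [set b | dilate t L (cube b)] =
    [set b | [set a | L (cube a)] (divv t b)].
  by apply/seteqP; split=> b /dilateE; apply.
apply: max_nat_divv => //.
(* The representative of the class of 0 makes the set of corners nonempty. *)
- by have [a [[La _] _]] := uniqS 0; exists a.
- exact/finite_nat_ubound/finite_image.
by move=> b /Snat /natvec_divv b0; rewrite (norm1_divv t) //; apply: b0.
Qed.

Lemma mdd_dilate t M L : (0 < t)%N -> L `<=` @unit_cubes R n ->
  mdd_mx M L <-> mdd_mx (t%:Z *: M) (dilate t L).
Proof.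
move=> t0 Lunit; rewrite /mdd_mx /mdd -!/(hyperL_mx _ _).
(* Only minimality remains to be compared, and [L] may be assumed to be a hyper-L, so that its
   corners are nonnegative. *)
suff H : hyperL_mx M L ->
    (forall a, L (cube a) -> norm1 a = min_nat (lengths M a)) <->
    (forall b, dilate t L (cube b) ->
      norm1 b = min_nat (lengths (t%:Z *: M) b)).
  have HL := hyperL_dilate t M L t0 Lunit.
  split=> -[h1 h2].
    split; first exact/HL.
    move=> b; rewrite natvec_weight_lengths; apply: (H h1).1 => a.
    by rewrite -natvec_weight_lengths; apply: h2.
  have h0 := HL.2 h1; split=> //.
  move=> b; rewrite natvec_weight_lengths; apply: (H h0).2 => a.
  by rewrite -natvec_weight_lengths; apply: h2.
move=> /(hyperL_staircase _ _ Lunit)[_ Snat _ _].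
(* The norm of [b] and its minimal length arise from those of the quotient by the same affine map of
   slope [t], which is injective since [t] is positive. *)
have lengthsE b : L (cube (divv t b)) ->
    (norm1 b = t * norm1 (divv t b) + norm1 (modv t b))%N /\
    min_nat (lengths (t%:Z *: M) b) =
      (t * min_nat (lengths M (divv t b)) + norm1 (modv t b))%N.
  move=> /Snat b0; split; first by apply: norm1_divv => //; apply/(natvec_divv t).
  by rewrite lengths_scale // min_nat_affine //; apply: lengths_neq0.
split=> minL => [b /dilateE Lb|a La].
  by have [-> ->] := lengthsE _ (Lb t0); rewrite minL //; apply: Lb.
have Lta : L (cube (divv t (t%:Z *: a))) by rewrite divvZ.
have [nE mE] := lengthsE _ Lta.
have := minL (t%:Z *: a) ((dilateE _ _ _ t0).2 Lta); rewrite nE mE divvZ //.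
by move=> /addIn/eqP; rewrite eqn_pmul2l // => /eqP.
Qed.

End Hyper.

Theorem theorem1 (R : realType) (n : nat) (M : 'M[int]_n) (t : nat)
    (hn : (1 <= n)%N) (hM : \det M != 0) (ht : (1 <= t)%N) :
  [/\ (forall L : set (set 'cV[R]_n), L `<=` @unit_cubes R n ->
         (hyperL_mx M L <-> hyperL_mx (t%:Z *: M) (dilate t L))),
      (forall L : set (set 'cV[R]_n), hyperL_mx M L ->
         diam_cubes (dilate t L) = (t * (diam_cubes L + n) - n)%N),
      (forall H : set (set 'cV[R]_n), H `<=` @unit_cubes R n ->
         (mdd_mx M H <-> mdd_mx (t%:Z *: M) (dilate t H))) &
      diameter (cayley_mx (t%:Z *: M)) =
        (t * (diameter (cayley_mx M) + n) - n)%N].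
Proof.
split=> [L|L|H|].
- exact: hyperL_dilate.
- exact: diam_dilate.
- exact: mdd_dilate.
- exact: diameter_scale.
Qed.
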